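(* Within the class of acknowledgement-based protocols, and within the class of ternary feedback protocols, with $k\ge2$ channels and $n\ge2$ players, there exists no equilibrium protocol with blocking step that has finite expected latency.
   Context: Contention game: $n$ players, channel set $K=\{1,\dots,k\}$, discrete slots $t=1,2,\dots$; each player has one packet and is initially pending. In each slot a pending player chooses (possibly at random) an action in $\{0,1,\dots,k\}$ ($0$ = no transmission, $a$ = transmit on channel $a$). A lone transmitter on a channel succeeds and leaves; two or more transmitters on a channel collide and remain pending. Latency $T_i$ = slot of player $i$'s successful transmission; players minimize expected latency. Acknowledgement-based feedback: only a player who attempted transmission learns whether she succeeded, and decision rules depend only on the personal action history. Ternary feedback: additionally every pending player learns the number of pending players in every slot. Anonymous protocol: common protocol whose decision rules do not depend on identity (players with equal histories get equal decision rules). Equilibrium protocol: when all players use it, no player at any slot and after any history can decrease her conditional expected latency by unilaterally deviating. An equilibrium with blocking step (EBS) is an anonymous equilibrium protocol for which there exists a finite time-step at which every pending player has probability $0$ of successful transmission. *)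

(* Defs.v *)
From HB Require Import structures.
From mathcomp Require Import all_boot all_order all_algebra.
From mathcomp Require Import all_classical all_reals all_analysis.
Set Implicit Arguments. Unset Strict Implicit. Unset Printing Implicit Defensive.
Import Order.TTheory GRing.Theory Num.Theory.
Local Open Scope ring_scope.

Inductive feedback := AckBased | Ternary.

Section Game.
Variables (R : realType) (n k : nat).

(* action 0 = no transmission, action a (1 <= a <= k) = transmit on channel a *)
Definition action := 'I_k.+1.
Definition profile := {ffun 'I_n -> action}.
(* one entry of a personal history: own action in the slot, and the number
   of players still pending after the slot (ternary feedback); for
   acknowledgement-based feedback this second component is always 0, i.e.
   carries no information.  A pending player's history implicitly contains
   the (failure) acknowledgements of all her transmissions. *)
Definition obs := (action * nat)%type.
Definition history := seq obs.

Definition is_dist (d : action -> R) :=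
  (forall a, 0 <= d a) /\ \sum_(a : action) d a = 1.
Definition rule := history -> action -> R.
Definition valid_rule (s : rule) := forall h, is_dist (s h).

Record state := State { pend : 'I_n -> bool ; hist : 'I_n -> history }.
Definition init_state : state := State (fun _ => true) (fun _ => [::]).

Definition succeeds (st : state) (p : profile) (i : 'I_n) : bool :=
  [&& pend st i, p i != ord0 &
      [forall j, (j != i) ==> ~~ (pend st j && (p j == p i))]].

Definition step (fb : feedback) (st : state) (p : profile) : state :=
  let pend' := fun i => pend st i && ~~ succeeds st p i in
  let cnt := #|[pred i | pend' i]| in
  State pend'
    (fun i => if pend st i
              then rcons (hist st i) (p i, if fb is Ternary then cnt else 0%N)
              else hist st i).

Definition run (fb : feedback) (ws : seq profile) : state :=
  foldl (step fb) init_state ws.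

Definition slot_prob (S : 'I_n -> rule) (st : state) (p : profile) (j : 'I_n) : R :=
  if pend st j then S j (hist st j) (p j) else (p j == ord0)%:R.

Fixpoint weight_from (fb : feedback) (S : 'I_n -> rule) (st : state)
    (ws : seq profile) : R :=
  match ws with
  | [::] => 1
  | p :: ws' => (\prod_(j < n) slot_prob S st p j) * weight_from fb S (step fb st p) ws'
  end.

Definition weight fb S (ws : seq profile) := weight_from fb S init_state ws.

Definition Prob fb (S : 'I_n -> rule) (t : nat) (E : seq profile -> bool) : R :=
  \sum_(w : t.-tuple profile) weight fb S w * (E w)%:R.

(* P(T_i > u) = P(i still pending after u slots) *)
Definition tailP fb S (i : 'I_n) (u : nat) : R :=
  Prob fb S u (fun w => pend (run fb w) i).

(* E[T_i] = sum_{u >= 0} P(T_i > u), in the extended reals *)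
Definition exp_latency fb S (i : 'I_n) : \bar R :=
  (\sum_(u <oo) (tailP fb S i u)%:E)%E.

Definition anon (p : rule) : 'I_n -> rule := fun _ => p.

Definition dev (p : rule) (i : 'I_n) (s : rule) : 'I_n -> rule :=
  fun j => if j == i then s else p.

Definition force (h : history) (s : rule) : rule :=
  fun h' a => if (size h' < size h)%N
              then ((nth (ord0, 0%N) h (size h')).1 == a)%:R
              else s h' a.

Definition hist_event fb (i : 'I_n) (h : history) (w : seq profile) : bool :=
  let st := run fb (take (size h) w) in pend st i && (hist st i == h).

(* conditional expected latency of player i given her history h (after
   t = size h slots), when from slot t+1 on she uses s and the others use p:
   E[T_i | h] = t + sum_{m >= 0} P(T_i > t+m | h). *)
Definition cond_exp_latency fb (p : rule) (i : 'I_n) (h : history) (s : rule) : \bar R :=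
  let S := dev p i (force h s) in
  let t := size h in
  let PA := Prob fb S t (hist_event fb i h) in
  ((t%:R : R)%:E +
   \sum_(m <oo) ((Prob fb S (t + m)
                     (fun w => pend (run fb w) i && hist_event fb i h w)) / PA)%:E)%E.

Definition anon_equilibrium fb (p : rule) : Prop :=
  valid_rule p /\
  forall (i : 'I_n) (h : history) (s : rule), valid_rule s ->
    0 < Prob fb (dev p i (force h p)) (size h) (hist_event fb i h) ->
    (cond_exp_latency fb p i h p <= cond_exp_latency fb p i h s)%E.

Definition has_blocking_step fb (p : rule) : Prop :=
  exists t : nat, forall i : 'I_n,
    Prob fb (anon p) t.+1
      (fun w => pend (run fb (take t w)) i && ~~ pend (run fb w) i) = 0.

Definition EBS fb (p : rule) : Prop :=
  anon_equilibrium fb p /\ has_blocking_step fb p.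

End Game.

(* Main.v *)
(* Before a blocking slot t+1 there is a reachable state in which at least two
   pending players have the same history h; as nobody may succeed in that slot,
   h must prescribe a single action a.  A player with history h can instead
   transmit on a channel b <> a, and afterwards behave as if she had played a.
   - With acknowledgements, a player's actions do not depend on the others while
     she is pending.  Coupling the two runs, the pending set after the deviation
     stays inside the original one, so no conditional tail P(T > u | h) grows.
   - With ternary feedback, observing the least possible number (at least 2) of
     pending players in every slot makes the symmetry of the state common
     knowledge, so h can be chosen such that all others play a for sure and the
     deviation succeeds with certainty.  This avoids analysing reactions
     to deviations, on which the equilibrium condition puts no constraint.
   In both cases the deviation succeeds in slot t+1 with positive probability,
   where p never does, so a finite expected latency strictly decreases. *)
Require Import Defs.
From HB Require Import structures.
From mathcomp Require Import all_boot all_order all_algebra.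
From mathcomp Require Import all_classical all_reals all_analysis.
From mathcomp Require Import ring zify.
Import Order.TTheory GRing.Theory Num.Theory.
Local Open Scope ring_scope.

Set Implicit Arguments.
Unset Strict Implicit.
Unset Printing Implicit Defensive.

Lemma eq0_or_gt0 (R : realType) (x : R) : 0 <= x -> x = 0 \/ 0 < x.
Proof. by rewrite le_eqVlt => /predU1P[]; [left|right]. Qed.

(** * Sums over words and over product distributions *)

Section TupleSums.
Variables (R : realType) (T : finType).
Implicit Type F : seq T -> R.

Lemma big_tuple0 F : \sum_(w : 0.-tuple T) F w = F [::].
Proof.
rewrite (big_pred1 [tuple]) // => w; rewrite [w]tuple0.
by apply/esym/eqP.
Qed.

Lemma big_tuple_cons (m : nat) F :
  \sum_(w : m.+1.-tuple T) F w = \sum_x \sum_(w : m.-tuple T) F (x :: w).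
Proof.
rewrite pair_big /= (reindex (fun u : T * m.-tuple T => cons_tuple u.1 u.2)) //=.
exists (fun w : m.+1.-tuple T => (thead w, behead_tuple w)) => [[x w] _|w _] /=.
  by congr pair; apply: val_inj.
by rewrite [RHS]tuple_eta; apply: val_inj.
Qed.

Lemma big_tuple_cat (a b : nat) F :
  \sum_(w : (a + b).-tuple T) F w
    = \sum_(u : a.-tuple T) \sum_(v : b.-tuple T) F (u ++ v).
Proof.
elim: a F => [|a IHa] F.
  by rewrite (big_tuple0 (fun u => \sum_(v : b.-tuple T) F (u ++ v))).
rewrite [RHS](big_tuple_cons _ (fun u => \sum_(v : b.-tuple T) F (u ++ v))).
rewrite [LHS]big_tuple_cons; apply: eq_bigr => x _.
exact: (IHa (fun w => F (x :: w))).
Qed.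

End TupleSums.

(** Image of a product measure under a coordinatewise map: each fibre is the product of the
    coordinate fibres. This is the tool for coupling two slots. *)
Lemma sum_pushforward (R : realType) (I T : finType) (phi : I -> T -> T)
    (mu mu' : I -> T -> R) (F : {ffun I -> T} -> R) :
  (forall j a, mu j a = \sum_(a' | phi j a' == a) mu' j a') ->
  \sum_(q : {ffun I -> T}) (\prod_j mu j (q j)) * F q =
  \sum_(q : {ffun I -> T}) (\prod_j mu' j (q j)) * F [ffun j => phi j (q j)].
Proof.
move=> muE.
rewrite [RHS](partition_big (fun q : {ffun I -> T} => [ffun j => phi j (q j)]) xpredT) //=.
apply: eq_bigr => q _.
under [RHS]eq_bigr => q' /eqP -> do [].
rewrite -mulr_suml; congr (_ * _).
under eq_bigr => j _ do rewrite muE.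
rewrite bigA_distr_big_dep; apply: eq_bigl => q'.
apply/familyP/eqP => [h|<- j]; last by rewrite ffunE unfold_in.
by apply/ffunP => j; rewrite ffunE; exact/eqP/(h j).
Qed.

(** * Run weights, survival probabilities and monotone coupling *)

Section Dynamics.
Variables (R : realType) (n k : nat) (fb : feedback).
Implicit Types (S : 'I_n -> rule R k) (st : state n k) (q : profile n k).
Implicit Types (w : seq (profile n k)) (h l : history k) (i j : 'I_n).

Definition slotw S st q : R := \prod_(j < n) slot_prob S st q j.
Definition rlen c := if fb is Ternary then c else 0%N.
Definition npend st := #|[pred i | pend st i]|.

Lemma pend_step st q i :
  pend (step fb st q) i = pend st i && ~~ succeeds st q i.
Proof. by []. Qed.

Lemma pend_stepW st q i : pend (step fb st q) i -> pend st i.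
Proof. by case/andP. Qed.

Lemma hist_step st q i : pend st i ->
  hist (step fb st q) i = rcons (hist st i) (q i, rlen (npend (step fb st q))).
Proof. by rewrite /= => ->; rewrite /rlen; case: fb. Qed.

Lemma succeedsP st q i :
  reflect [/\ pend st i, q i != ord0 &
            forall j, j != i -> pend st j -> q j != q i] (succeeds st q i).
Proof.
apply: (iffP and3P) => [] [pi qi]; [move/forallP => H|move=> H]; split => //.
  by move=> j ji pj; have := H j; rewrite ji pj.
by apply/forallP => j; apply/implyP => ji; apply/negP => /andP[/(H _ ji)/negP].
Qed.

Lemma pend_foldl w st i : pend (foldl (step fb) st w) i -> pend st i.
Proof. by elim: w st => //= q w IH st /IH /pend_stepW. Qed.

Lemma run_rcons w q : run fb (rcons w q) = step fb (run fb w) q.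
Proof. by rewrite /run foldl_rcons. Qed.

Lemma run_cat w w' : run fb (w ++ w') = foldl (step fb) (run fb w) w'.
Proof. by rewrite /run foldl_cat. Qed.

Lemma weight_from_cat S st w w' :
  weight_from fb S st (w ++ w')
    = weight_from fb S st w * weight_from fb S (foldl (step fb) st w) w'.
Proof. by elim: w st => [|q w IH] st /=; rewrite ?mul1r // IH mulrA. Qed.

Lemma weight_rcons S w q :
  weight fb S (rcons w q) = weight fb S w * slotw S (run fb w) q.
Proof. by rewrite /weight -cats1 weight_from_cat /= mulr1. Qed.

Lemma weight_cat S w w' :
  weight fb S (w ++ w') = weight fb S w * weight_from fb S (run fb w) w'.
Proof. exact: weight_from_cat. Qed.

Definition valid_profile S := forall j, valid_rule (S j).

Lemma slot_prob_ge0 S st q j : valid_profile S -> 0 <= slot_prob S st q j.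
Proof. by move=> vS; rewrite /slot_prob; case: ifP => // _; have [] := vS j (hist st j). Qed.

Lemma slotw_ge0 S st q : valid_profile S -> 0 <= slotw S st q.
Proof. by move=> vS; apply: prodr_ge0 => j _; exact: slot_prob_ge0. Qed.

Lemma slotw_gt0P S st q : valid_profile S ->
  reflect (forall j, 0 < slot_prob S st q j) (0 < slotw S st q).
Proof.
move=> vS; apply: (iffP idP) => [h j|h]; last by apply: prodr_gt0.
rewrite lt_neqAle slot_prob_ge0 // andbT eq_sym.
by move: h; rewrite lt0r => /andP[/prodf_neq0 nz _]; exact: nz.
Qed.

Lemma weight_from_ge0 S st w : valid_profile S -> 0 <= weight_from fb S st w.
Proof.
by move=> vS; elim: w st => //= q w IH st; apply: mulr_ge0 => //; exact: slotw_ge0.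
Qed.

Lemma weight_ge0 S w : valid_profile S -> 0 <= weight fb S w.
Proof. exact: weight_from_ge0. Qed.

Lemma weight_rcons_gt0 S w q : valid_profile S ->
  (0 < weight fb S (rcons w q)) = (0 < weight fb S w) && (0 < slotw S (run fb w) q).
Proof.
move=> vS; rewrite weight_rcons !lt0r mulf_eq0 negb_or.
by rewrite mulr_ge0 ?weight_ge0 ?slotw_ge0 // !andbT.
Qed.

(** The start state is arbitrary, which permits induction on the first slot. *)
Definition expect S st m (F : state n k -> R) : R :=
  \sum_(w : m.-tuple (profile n k))
     weight_from fb S st w * F (foldl (step fb) st w).

Lemma expect0 S st F : expect S st 0 F = F st.
Proof.
rewrite /expect (big_tuple0 (fun w => weight_from fb S st w * F (foldl (step fb) st w))).
by rewrite mul1r.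
Qed.

Lemma expectS S st m F :
  expect S st m.+1 F = \sum_q slotw S st q * expect S (step fb st q) m F.
Proof.
rewrite /expect (big_tuple_cons _ (fun w => weight_from fb S st w * F (foldl (step fb) st w))).
by apply: eq_bigr => q _; rewrite mulr_sumr; apply: eq_bigr => w _ /=; rewrite mulrA.
Qed.

Lemma sum_slotw S st : valid_profile S -> \sum_q slotw S st q = 1.
Proof.
move=> vS.
pose mu j (a : action k) := if pend st j then S j (hist st j) a else (a == ord0)%:R.
transitivity (\prod_j \sum_a mu j a); first by rewrite bigA_distr_bigA.
rewrite big1 // => j _; rewrite /mu; case: (pend st j).
  by have [] := vS j (hist st j).
by rewrite (bigD1 ord0) //= big1 ?addr0 // => a /negbTE ->.
Qed.

Lemma expect_ge0 S st m F : valid_profile S -> (forall st', 0 <= F st') ->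
  0 <= expect S st m F.
Proof.
by move=> vS F0; apply: sumr_ge0 => w _; rewrite mulr_ge0 ?weight_from_ge0.
Qed.

Definition survive S i st m := expect S st m (fun st' => (pend st' i)%:R).

Lemma survive_ge0 S i st m : valid_profile S -> 0 <= survive S i st m.
Proof. by move=> vS; apply: expect_ge0. Qed.

Lemma survive_gone S i st m : ~~ pend st i -> survive S i st m = 0.
Proof.
move=> pi; apply: big1 => w _.
by case: (boolP (pend _ i)) => [/pend_foldl|]; rewrite ?(negbTE pi) ?mulr0.
Qed.

(* A later history extends the present one, so two strategy profiles that agree
   on all extensions of the present histories are indistinguishable. *)
Lemma weight_from_ext S S' st w :
  (forall j l a, pend st j -> S j (hist st j ++ l) a = S' j (hist st j ++ l) a) ->
  weight_from fb S st w = weight_from fb S' st w.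
Proof.
elim: w st => //= q w IH st SS'; congr (_ * _).
  apply: eq_bigr => j _; rewrite /slot_prob; case: ifP => // pj.
  by have := SS' j [::] (q j) pj; rewrite cats0.
apply: IH => j l a /pend_stepW pj.
by rewrite hist_step // cat_rcons; apply: SS'.
Qed.

(* With acknowledgement-based feedback a pending player's actions do not depend
   on the others, so fewer competitors can be coupled with more of them, the
   pending set of the former staying inside that of the latter. *)
Lemma survive_mono S S' i st st' m : fb = AckBased ->
  valid_profile S -> valid_profile S' ->
  (forall j, pend st j -> pend st' j) ->
  (forall j l a, pend st j -> S j (hist st j ++ l) a = S' j (hist st' j ++ l) a) ->
  survive S i st m <= survive S' i st' m.
Proof.
move=> fbA vS vS'; elim: m st st' => [|m IH] st st' sub SS'.
  by rewrite /survive !expect0 ler_nat; have := sub i; case: (pend st i) => // ->.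
rewrite /survive !expectS.
(* The coupling: draw the actions of the larger game and silence those who have already left the
   smaller one. *)
pose phi j (a : action k) := if pend st j then a else ord0.
pose mu (S : 'I_n -> rule R k) (st : state n k) j (a : action k) :=
  if pend st j then S j (hist st j) a else (a == ord0)%:R.
rewrite (sum_pushforward (phi := phi) (mu := mu S st) (mu' := mu S' st')); last first.
  move=> j a; rewrite /mu /phi; case: ifP => [pj|npj].
    rewrite (sub j pj) big_pred1_eq.
    by have := SS' j [::] a pj; rewrite !cats0.
  have [_|a0] := eqVneq a ord0; last by rewrite big_pred0.
  case: (pend st' j); first by have [_ ->] := vS' j (hist st' j).
  by rewrite (bigD1 ord0) //= big1 ?addr0 // => b /negbTE ->.
apply: ler_sum => q _; apply: ler_wpM2l; first exact: slotw_ge0.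
apply: IH => [j|j l a /pend_stepW pj].
  rewrite !pend_step => /andP[pj nsj]; rewrite sub //=.
  (* A lone transmitter among more players is also alone among fewer. *)
  apply: contra nsj => /succeedsP[_ qj uj]; apply/succeedsP.
  split => //; rewrite ?ffunE /phi pj // => j' j'j pj'.
  by rewrite ffunE /phi pj'; apply: uj => //; apply: sub.
rewrite !hist_step ?sub // ffunE /phi pj /rlen fbA !cat_rcons.
exact: SS'.
Qed.

(** The event that [h] is observed depends on the first [size h] slots only, so the weight splits
    there. *)
Lemma Prob_survive S i h m :
  Prob fb S (size h + m) (fun w => pend (run fb w) i && hist_event fb i h w) =
  \sum_(w : (size h).-tuple (profile n k))
    weight fb S w * (hist_event fb i h w)%:R * survive S i (run fb w) m.
Proof.
rewrite /Prob (big_tuple_cat (size h) m (fun w => weight fb S w *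
  (pend (run fb w) i && hist_event fb i h w)%:R)).
apply: eq_bigr => u _; rewrite /survive /expect mulr_sumr; apply: eq_bigr => v _.
rewrite weight_cat run_cat.
have -> : hist_event fb i h (u ++ v) = hist_event fb i h u.
  by rewrite /hist_event take_size_cat ?size_tuple // take_oversize ?size_tuple.
by rewrite -mulnb natrM; ring.
Qed.

End Dynamics.

(** * Symmetric histories under an anonymous rule *)

Section AnonymousRule.
Variables (R : realType) (n k : nat) (fb : feedback) (p : rule R k).
Hypothesis vp : valid_rule p.
Implicit Types (st : state n k) (q : profile n k) (w : seq (profile n k)).
Implicit Types (h l : history k) (i j : 'I_n) (s : rule R k).

Lemma valid_anon : valid_profile (@anon R n k p).
Proof. by move=> j; exact: vp. Qed.

Lemma is_dist_delta (b : action k) : @is_dist R k (fun a => (b == a)%:R).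
Proof.
split=> [a|]; first exact: ler0n.
by rewrite (bigD1 b) //= eqxx big1 ?addr0 // => a; rewrite eq_sym => /negbTE ->.
Qed.

Lemma valid_force h s : valid_rule s -> valid_rule (force h s).
Proof.
by move=> vs h'; rewrite /force; case: (_ < _)%N; [exact: is_dist_delta|exact: vs].
Qed.

Lemma valid_dev i s : valid_rule s -> valid_profile (dev p i s).
Proof. by move=> vs j; rewrite /dev; case: eqP. Qed.

Lemma force_after h s h' a : (size h <= size h')%N -> force h s h' a = s h' a.
Proof. by rewrite /force ltnNge => ->. Qed.

(** The factor that a player's own choices along [h] contribute to the weight of a run. *)
Definition hist_weight h : R :=
  \prod_(u < size h) p (take u h) (nth (ord0, 0%N) h u).1.

Lemma hist_weight_rcons h x : hist_weight (rcons h x) = hist_weight h * p h x.1.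
Proof.
rewrite /hist_weight size_rcons big_ord_recr /= nth_rcons ltnn eqxx.
rewrite -cats1 take_size_cat //; congr (_ * _); apply: eq_bigr => u _.
by rewrite nth_cat ltn_ord takel_cat // ltnW.
Qed.

(** The two profiles differ only in the factors of [i]: forced actions have probability 1, where [p]
    contributes the factors of [hist_weight]. *)
Lemma weight_anon_force i h s w :
  pend (run fb w) i -> prefix (hist (run fb w) i) h ->
  weight fb (anon p) w
    = hist_weight (hist (run fb w) i) * weight fb (dev p i (force h s)) w.
Proof.
elim/last_ind: w => [|w q IH].
  by rewrite /hist_weight /weight big_ord0 mulr1.
rewrite run_rcons => pi; rewrite hist_step ?(pend_stepW pi) // => pre.
have [l def_h] := prefixP pre.
have {}pi := pend_stepW pi; set g := hist (run fb w) i in pre def_h *.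
have szg : (size g < size h)%N by rewrite def_h size_cat size_rcons leq_addr.
have nthg : (nth (ord0, 0%N) h (size g)).1 = q i.
  by rewrite def_h nth_cat size_rcons ltnSn nth_rcons ltnn eqxx.
have {}IH := IH pi; rewrite !weight_rcons hist_weight_rcons IH; last first.
  by rewrite -/g def_h cat_rcons prefix_prefix.
rewrite /slotw (bigD1 i) //= [in RHS](bigD1 i) //= /slot_prob pi /anon /dev eqxx.
rewrite -/g /force szg nthg eqxx mul1r.
rewrite -!mulrA; congr (_ * _); rewrite mulrCA; congr (_ * (_ * _)).
by apply: eq_bigr => j /negbTE ->.
Qed.

Definition same_hist h st := forall j, pend st j -> hist st j = h.

Lemma slotw_anon_gt0 st q :
  (forall j, pend st j -> 0 < p (hist st j) (q j)) ->
  (forall j, ~~ pend st j -> q j = ord0) -> 0 < slotw (anon p) st q.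
Proof.
move=> pos z; apply/(slotw_gt0P _ _ valid_anon) => j; rewrite /slot_prob.
by case: (boolP (pend st j)) => [/pos //|/z ->]; rewrite eqxx ltr01.
Qed.

Lemma slotw_anon_pend st q j :
  0 < slotw (anon p) st q -> pend st j -> 0 < p (hist st j) (q j).
Proof.
by move=> /(slotw_gt0P _ _ valid_anon)/(_ j); rewrite /slot_prob => + pj; rewrite pj.
Qed.

Lemma slotw_anon_out st q j :
  0 < slotw (anon p) st q -> ~~ pend st j -> q j = ord0.
Proof.
move=> /(slotw_gt0P _ _ valid_anon)/(_ j); rewrite /slot_prob => + /negbTE pj.
by rewrite pj; case: eqP => //; rewrite ltxx.
Qed.

Lemma support_nonempty h : exists a, 0 < p h a.
Proof.
apply/existsP; apply: contraT => /existsPn np.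
have [pos sum1] := vp h; move: sum1; rewrite big1 ?eq_sym => [|a _].
  by move/esym/eqP; rewrite oner_eq0.
by apply/eqP; rewrite eq_le pos leNgt np.
Qed.

(* Two different residual actions could be merged: letting a single player keep
   the channel where several collided, and moving the others to the remaining
   action, makes exactly that player leave. *)
Lemma fewer_pending h st q i j :
  same_hist h st -> 0 < slotw (anon p) st q ->
  pend (step fb st q) i -> pend (step fb st q) j -> q i <> q j ->
  exists q', [/\ 0 < slotw (anon p) st q',
                 (npend (step fb st q') < npend (step fb st q))%N &
                 (2 <= npend (step fb st q'))%N].
Proof.
(* Of two different actions at least one is a channel; call it [q j]. *)
wlog qj0 : i j / q j != ord0.
  move=> W sh pq pi pj /eqP qij.
  have [qj0|qj0] := eqVneq (q j) ord0; last by apply: (W i j) => //; exact/eqP.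
  by apply: (W j i) => //; [rewrite -qj0|apply/eqP; rewrite eq_sym].
move=> sh pq pi pj /eqP qij.
have [spi spj] := (pend_stepW pi, pend_stepW pj).
pose q' : profile n k :=
  [ffun l => if [&& pend st l, q l == q j & l != j] then q i else q l].
have q'i : q' i = q i by rewrite ffunE (negbTE qij) /= andbF.
have q'j : q' j = q j by rewrite ffunE !eqxx /= andbF.
(* Since [j] failed on a channel, someone collided with her; [q'] moves that player to [q i]. *)
have [j' j'j [spj' qj']] : exists2 j', j' != j & pend st j' /\ q j' = q j.
  move: pj; rewrite pend_step spj /= => /negP nsj.
  case: (pickP [pred j' | [&& j' != j, pend st j' & q j' == q j]]) => [j'|none].
    by case/and3P => ? ? /eqP ?; exists j'.
  case: nsj; apply/succeedsP; split=> // l lj pl; apply/eqP => ql.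
  by have := none l; rewrite /= lj pl ql eqxx.
have q'j' : q' j' = q i by rewrite ffunE spj' qj' eqxx j'j.
have ij' : i != j' by apply: contraNneq qij => ->; rewrite qj'.
exists q'; split.
- apply: slotw_anon_gt0 => l; rewrite ffunE.
    move=> pl; case: ifP => _; last exact: (slotw_anon_pend pq).
    by rewrite (sh _ pl) -(sh _ spi); exact: (slotw_anon_pend pq).
  by move=> /[dup] pl /negbTE ->; exact: (slotw_anon_out pq).
- apply/proper_card/properP; split; last first.
    exists j => //; rewrite inE pend_step negb_and negbK; apply/orP; right.
    apply/succeedsP; split; rewrite ?q'j // => l lj pl; rewrite ffunE pl lj andbT.
    by case: ifP => [_ //|/negbT].
  (* A success under [q] is on a channel other than [q i] and [q j], hence undisturbed by [q']. *)
  apply/fintype.subsetP => l; rewrite !inE => /andP[pl nsl].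
  rewrite pend_step pl /=; apply: contra nsl => /succeedsP[_ ql0 ul].
  have lj : l != j.
    apply: contraTneq pj => lj; rewrite pend_step negb_and negbK -lj.
    by apply/orP; right; apply/succeedsP.
  have li : l != i.
    apply: contraTneq pi => li; rewrite pend_step negb_and negbK -li.
    by apply/orP; right; apply/succeedsP.
  have qlj : q l != q j by rewrite eq_sym; apply: ul; rewrite // eq_sym.
  have q'l : q' l = q l by rewrite ffunE (negbTE qlj) /= andbF.
  apply/succeedsP; rewrite q'l; split=> // m ml pm; rewrite ffunE.
  by case: ifP => _; apply: ul => //; rewrite eq_sym.
(* Both [i] and [j'] now play [q i], so they collide or are both silent. *)
- have stay x y : x != y -> pend st x -> pend st y -> q' x = q' y ->
      pend (step fb st q') x.
    move=> xy px py qxy; rewrite pend_step px /=; apply/succeedsP => -[_ _].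
    by move/(_ y); rewrite eq_sym xy py qxy => /(_ isT isT)/eqP.
  rewrite (_ : 2%N = #|[set i; j']|); last by rewrite cards2 ij'.
  apply/subset_leq_card/fintype.subsetP => l; rewrite !inE => /orP[]/eqP ->.
    by apply: (stay i j'); rewrite ?q'i ?q'j'.
  by apply: (stay j' i); rewrite ?q'i ?q'j' // eq_sym.
Qed.

Lemma two_pending st : (2 <= npend st)%N ->
  exists i j, [/\ i != j, pend st i & pend st j].
Proof.
by case/card_gt1P => i [j] []; rewrite !inE => pi pj ij; exists i, j.
Qed.

Lemma constant_slot h st a : same_hist h st -> (2 <= npend st)%N -> 0 < p h a ->
  let q := [ffun j => if pend st j then a else ord0] in
  0 < slotw (anon p) st q /\ (forall j, pend (step fb st q) j = pend st j).
Proof.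
move=> sh two pa q; split.
  apply: slotw_anon_gt0 => j; rewrite ffunE; first by move=> pj; rewrite pj sh.
  by move/negbTE ->.
move=> j; rewrite pend_step; case: (boolP (pend st j)) => //= pj.
apply/succeedsP => -[_ _ uj].
have [x [y [xy px py]]] := two_pending two.
have [z zj pz] : exists2 z, z != j & pend st z.
  by have [xj|xj] := eqVneq x j; [exists y; rewrite // -xj eq_sym|exists x].
by have := uj z zj pz; rewrite !ffunE pj pz eqxx.
Qed.

(* The number of pending players is part of a ternary history. Going, slot by
   slot, to the smallest number that is at least 2, all pending players share a
   history which makes this fact common knowledge. *)
Lemma common_history (n2 : (2 <= n)%N) t :
  exists h, [/\ size h = t,
    exists w, [/\ size w = t, 0 < weight fb (anon p) w,
                  (2 <= npend (run fb w))%N & same_hist h (run fb w)] &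
    fb = Ternary -> forall w i, size w = t -> 0 < weight fb (anon p) w ->
      pend (run fb w) i -> hist (run fb w) i = h -> same_hist h (run fb w)].
Proof.
elim: t => [|t [h [sz_h [w [sz_w pw w2 sh_w]] ck]]].
  exists [::]; split=> //; last by move=> _ w i /size0nil ->.
  exists [::]; split=> //.
  by rewrite (_ : npend _ = n) // /npend -[RHS]card_ord; apply: eq_card.
(* The counts, at least 2, that one more slot can produce when all pending players share [h]. *)
pose C c := `[< exists w q, [/\ size w = t, 0 < weight fb (anon p) (rcons w q),
   same_hist h (run fb w), npend (run fb (rcons w q)) = c & (2 <= c)%N] >].
have exC : exists c, C c.
  have [a pa] := support_nonempty h.
  have [pq same_pend] := constant_slot sh_w w2 pa.
  set q := [ffun _ => _] in pq same_pend.
  exists (npend (run fb w)); apply/asboolP; exists w, q; split=> //.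
    by rewrite weight_rcons_gt0 ?pw //; exact: valid_anon.
  by rewrite run_rcons; apply: eq_card => j; rewrite !inE same_pend.
case: (ex_minnP exC) => c /asboolP[w1 [q1 [sz_w1 pw1 sh1 c1 c2]]] cmin.
(* Two different actions among those left would contradict the minimality of [c]. *)
have agree u q i j : size u = t -> 0 < weight fb (anon p) (rcons u q) ->
    same_hist h (run fb u) -> npend (run fb (rcons u q)) = c ->
    pend (run fb (rcons u q)) i -> pend (run fb (rcons u q)) j -> q i = q j.
  rewrite run_rcons weight_rcons_gt0; last exact: valid_anon.
  move=> su /andP[pu pq] shu cu pi pj; apply: contrapT => qij.
  have [q' [pq' lt' ge']] := fewer_pending shu pq pi pj qij.
  suff : (c <= npend (step fb (run fb u) q'))%N by rewrite leqNgt -cu lt'.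
  apply: cmin; apply/asboolP; exists u, q'; split=> //; last by rewrite run_rcons.
  by rewrite weight_rcons_gt0 ?pu //; exact: valid_anon.
have [i0 [_ [_ pi0 _]]] : exists i j, [/\ i != j, pend (run fb (rcons w1 q1)) i
    & pend (run fb (rcons w1 q1)) j] by apply: two_pending; rewrite c1.
exists (rcons h (q1 i0, rlen fb c)); split; first by rewrite size_rcons sz_h.
  exists (rcons w1 q1); rewrite size_rcons sz_w1 c1; split=> // j pj.
  rewrite run_rcons hist_step; last by apply: (@pend_stepW _ _ fb _ q1); rewrite -run_rcons.
  rewrite -run_rcons c1 sh1; last by apply: (@pend_stepW _ _ fb _ q1); rewrite -run_rcons.
  by rewrite (agree w1 q1 j i0).
(* The ternary history reveals the count [c], so [agree] applies to every run in which some pending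
   player sees this history. *)
move=> fbT u i; case/lastP: u => // u q; rewrite size_rcons => -[su] puq pi.
have pui : pend (run fb u) i by apply: (@pend_stepW _ _ fb _ q); rewrite -run_rcons.
rewrite run_rcons hist_step // -run_rcons => /rcons_inj[hi qi].
have rlenT m : rlen fb m = m by rewrite /rlen fbT.
rewrite !rlenT => cu.
have /andP[pu _] : (0 < weight fb (anon p) u) && (0 < slotw (anon p) (run fb u) q).
  by rewrite -weight_rcons_gt0 //; exact: valid_anon.
have shu := ck fbT u i su pu pui hi.
move=> j pj.
have puj : pend (run fb u) j by apply: (@pend_stepW _ _ fb _ q); rewrite -run_rcons.
by rewrite run_rcons hist_step // -run_rcons shu // -qi cu rlenT (agree u q j i).
Qed.

(** A vanishing sum of nonnegative terms has only zero terms. *)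
Lemma blocking_stays t w q j :
  Prob fb (anon p) t.+1
    (fun w => pend (run fb (take t w)) j && ~~ pend (run fb w) j) = 0 ->
  size w = t -> 0 < weight fb (anon p) (rcons w q) ->
  pend (run fb w) j -> pend (run fb (rcons w q)) j.
Proof.
move=> block sw pw pj; apply: contraT => npj.
have szw : size (rcons w q) == t.+1 by rewrite size_rcons sw.
have /= := psumr_eq0P _ block (i := Tuple szw) isT.
have -> : take t (rcons w q) = w by rewrite -sw -cats1 take_size_cat.
rewrite pj npj mulr1 => W.
move: pw; rewrite W ?ltxx // => u _.
by rewrite mulr_ge0 ?ler0n ?weight_ge0 //; exact: valid_anon.
Qed.

(** Were two actions possible, one player could play the nonzero one alone while all others play the
    other, and would succeed with positive probability. *)
Lemma blocking_pure h w a a' :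
  (forall q j, 0 < weight fb (anon p) (rcons w q) ->
     pend (run fb w) j -> pend (run fb (rcons w q)) j) ->
  0 < weight fb (anon p) w -> (2 <= npend (run fb w))%N ->
  same_hist h (run fb w) -> 0 < p h a -> 0 < p h a' -> a = a'.
Proof.
move=> stays pw two sh; wlog a0 : a a' / a != ord0.
  move=> W pa pa'; have [a0|a0] := eqVneq a ord0; last exact: W.
  have [a'0|a'0] := eqVneq a' ord0; first by rewrite a0.
  by apply/esym/W.
move=> pa pa'; apply/eqP; apply: contraT => aa'.
have [i [_ [_ pi _]]] := two_pending two.
pose q : profile n k :=
  [ffun j => if pend (run fb w) j then if j == i then a else a' else ord0].
have : 0 < weight fb (anon p) (rcons w q).
  rewrite weight_rcons_gt0 ?pw /=; last exact: valid_anon.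
  apply: slotw_anon_gt0 => j; rewrite ffunE; last by move/negbTE ->.
  by move=> pj; rewrite pj sh //; case: ifP.
move/stays => /(_ i pi); rewrite run_rcons pend_step => /andP[_] /succeedsP[].
split=> //; first by rewrite ffunE pi eqxx.
by move=> j ji pj; rewrite !ffunE pi pj eqxx (negbTE ji) eq_sym.
Qed.

End AnonymousRule.

(** * Strict comparison of series *)

Lemma nneseries_lt1 (R : realType) (x y : nat -> R) m :
  (forall m, 0 <= x m) -> (forall m, x m <= y m) -> x m < y m ->
  (\sum_(u <oo) (y u)%:E < +oo)%E ->
  (\sum_(u <oo) (x u)%:E < \sum_(u <oo) (y u)%:E)%E.
Proof.
move=> x0 xy xym finy.
have y0 u : 0 <= y u := le_trans (x0 u) (xy u).
rewrite (nneseriesD1 (n := m)) => [|u _|//]; last by rewrite lee_fin.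
rewrite [ltRHS](nneseriesD1 (n := m)) => [|u _|//]; last by rewrite lee_fin.
move: finy; rewrite (nneseriesD1 (n := m)) => [|u _|//]; last by rewrite lee_fin.
move=> finy; apply: lte_leD; rewrite ?lte_fin //.
  rewrite ge0_fin_numE; last by apply: nneseries_ge0 => u _ _; rewrite lee_fin.
  apply: (le_lt_trans _ finy).
  apply: (@le_trans _ _ (\sum_(0 <= u <oo | u != m) (y u)%:E)%E).
    by apply: lee_nneseries => u _; rewrite lee_fin.
  by rewrite leeDr // lee_fin.
by apply: lee_nneseries => u _; rewrite lee_fin.
Qed.

(** * Conditioning on a history and the mimicking deviation *)

Section Deviation.
Variables (R : realType) (n k : nat) (fb : feedback) (p : rule R k).
Hypothesis vp : valid_rule p.
Implicit Types (st : state n k) (q : profile n k) (w : seq (profile n k)).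
Implicit Types (h l : history k) (i j : 'I_n) (s : rule R k).

Lemma hist_weight_gt0 i h w : 0 < weight fb (anon p) w ->
  pend (run fb w) i -> hist (run fb w) i = h -> 0 < hist_weight p h.
Proof.
move=> pw pi hi; rewrite lt0r prodr_ge0 ?andbT => [|u _]; last by have [] := vp (take u h).
move: pw; rewrite (weight_anon_force (h := h) p p pi) hi ?prefix_refl //.
by apply: contraTneq => ->; rewrite mul0r ltxx.
Qed.

Lemma hist_eventP i h w : size w = size h ->
  reflect (pend (run fb w) i /\ hist (run fb w) i = h) (hist_event fb i h w).
Proof.
by move=> sw; rewrite /hist_event take_oversize ?sw //; apply: (iffP andP) => -[? /eqP].
Qed.

(** The right-hand side is free of [s]: conditionally on [h], the past has the same law for every
    continuation. *)
Lemma weight_force i h s w : 0 < hist_weight p h -> size w = size h ->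
  hist_event fb i h w ->
  weight fb (dev p i (force h s)) w = (hist_weight p h)^-1 * weight fb (anon p) w.
Proof.
move=> H0 sw /(hist_eventP _ sw)[pi hi].
by rewrite (weight_anon_force (h := h) p s pi) hi ?prefix_refl // mulKf // gt_eqF.
Qed.

(** Transfers finiteness from the unconditional latency to the conditional one. *)
Lemma survive_tail i h m : 0 < hist_weight p h ->
  Prob fb (dev p i (force h p)) (size h + m)
    (fun w => pend (run fb w) i && hist_event fb i h w)
  <= (hist_weight p h)^-1 * tailP fb (anon p) i (size h + m).
Proof.
move=> H0; apply: (@le_trans _ _ ((hist_weight p h)^-1 *
  Prob fb (anon p) (size h + m) (fun w => pend (run fb w) i && hist_event fb i h w))).
  rewrite !Prob_survive mulr_sumr; apply: ler_sum => w _.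
  case: (boolP (hist_event fb i h w)) => [he|_]; last by rewrite !(mulr0, mul0r).
  have [pi hi] := hist_eventP i (size_tuple w) he.
  rewrite weight_force ?size_tuple // !mulr1 -mulrA le_eqVlt; apply/orP; left.
  apply/eqP; congr (_ * (_ * _)); apply: eq_bigr => v _; congr (_ * _).
  apply: weight_from_ext => j l a pj; rewrite /dev /anon.
  by have [->|//] := eqVneq j i; rewrite force_after // hi size_cat leq_addr.
rewrite ler_wpM2l ?invr_ge0 ?(ltW H0) // /tailP /Prob; apply: ler_sum => w _.
rewrite ler_wpM2l ?weight_ge0 //.
by rewrite ler_nat; case: (pend _ _) => //; case: (hist_event _ _ _ _).
Qed.

(* Play b after h, and from then on behave as if a had been played instead. *)
Definition mimic h (a b : action k) : rule R k := fun h' c =>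
  if h' == h then (b == c)%:R
  else if prefix (rcons h (b, 0%N)) h'
       then p (rcons h (a, 0%N) ++ drop (size h).+1 h') c
       else p h' c.

Lemma valid_mimic h a b : valid_rule (mimic h a b).
Proof.
move=> h'; rewrite /mimic; case: eqP => _; first exact: is_dist_delta.
by case: (prefix _ _); exact: vp.
Qed.

(** The entry [0] is what acknowledgement-based feedback records; in the ternary case the deviation
    will succeed at once. *)
Lemma mimic_after h a b l c :
  mimic h a b (rcons h (b, 0%N) ++ l) c = p (rcons h (a, 0%N) ++ l) c.
Proof.
rewrite /mimic; case: eqP => [/(congr1 size)|_].
  by rewrite size_cat size_rcons; lia.
by rewrite prefix_prefix -(size_rcons h (b, 0%N)) drop_size_cat.
Qed.

Definition switch i (b : action k) q : profile n k :=
  [ffun j => if j == i then b else q j].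

(** Draw all actions by [p], then overwrite that of [i]: the deviating slot is expressed over the
    same [q] as the honest one. *)
Lemma survive_mimic i h a b st m : pend st i -> hist st i = h ->
  survive fb (dev p i (force h (mimic h a b))) i st m.+1 =
  \sum_q slotw (anon p) st q *
    survive fb (dev p i (force h (mimic h a b))) i (step fb st (switch i b q)) m.
Proof.
move=> pi hi; set S := dev _ _ _; rewrite /survive expectS.
pose mu (S : 'I_n -> rule R k) j (c : action k) :=
  if pend st j then S j (hist st j) c else (c == ord0)%:R.
rewrite (sum_pushforward (phi := fun j c => if j == i then b else c)
  (mu := mu S) (mu' := mu (anon p))) // => j c.
rewrite /mu /S /dev; have [->|ji] := eqVneq j i; last by rewrite big_pred1_eq.
rewrite pi hi force_after // /mimic eqxx; case: (b == c); last by rewrite big_pred0.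
by have [_ ->] := vp h.
Qed.

Lemma survive_honest i h st m : hist st i = h ->
  survive fb (dev p i (force h p)) i st m.+1 =
  \sum_q slotw (anon p) st q *
    survive fb (dev p i (force h p)) i (step fb st q) m.
Proof.
move=> hi; rewrite /survive expectS; apply: eq_bigr => q _; congr (_ * _).
apply: eq_bigr => j _; rewrite /slot_prob /dev /anon.
by have [->|//] := eqVneq j i; rewrite hi force_after.
Qed.

Lemma switch_succeeds i h a b st q : same_hist h st ->
  (forall c, 0 < p h c -> c = a) -> b != ord0 -> b != a ->
  0 < slotw (anon p) st q -> pend st i -> succeeds st (switch i b q) i.
Proof.
move=> sh pure b0 ba pq pi; apply/succeedsP; rewrite !ffunE eqxx; split=> // j ji pj.
rewrite ffunE (negbTE ji); have := slotw_anon_pend vp pq pj.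
by rewrite sh // => /pure ->; rewrite eq_sym.
Qed.

(** * Deviating in a blocking slot *)

Section Blocked.
Variables (i : 'I_n) (h : history k) (a b : action k).
Hypotheses (pure : forall c, 0 < p h c -> c = a) (b0 : b != ord0) (ba : b != a).
Hypothesis stays : forall w q j, size w = size h ->
  0 < weight fb (anon p) (rcons w q) ->
  pend (run fb w) j -> pend (run fb (rcons w q)) j.
Let s := mimic h a b.
Let Ss := @dev R n k p i (force h s).
Let Sp := @dev R n k p i (force h p).

Let vSs : valid_profile Ss.
Proof. by apply: valid_dev => //; apply: valid_force; exact: valid_mimic. Qed.

Let vSp : valid_profile Sp.
Proof. by apply: valid_dev => //; exact: valid_force. Qed.

Lemma survive_switch_le w m :
  (fb = Ternary -> same_hist h (run fb w)) ->
  size w = size h -> 0 < weight fb (anon p) w ->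
  pend (run fb w) i -> hist (run fb w) i = h ->
  survive fb Ss i (run fb w) m <= survive fb Sp i (run fb w) m.
Proof.
move=> ck sw pw pi hi; case: m => [|m]; first by rewrite /survive !expect0.
rewrite survive_mimic // survive_honest //; apply: ler_sum => q _.
have [->|pq] := eq0_or_gt0 (slotw_ge0 (run fb w) q (valid_anon vp)); first by rewrite !mul0r.
apply: ler_wpM2l; first exact: ltW.
have qi : q i = a by apply: pure; rewrite -hi; exact: slotw_anon_pend pq pi.
have pwq : 0 < weight fb (anon p) (rcons w q).
  by rewrite weight_rcons_gt0 ?pw //; exact: valid_anon.
have [fbT|fbA] : fb = Ternary \/ fb = AckBased by case: (fb); [right|left].
  (* Ternary: all pending players share [h], so the deviator leaves immediately. *)
  rewrite survive_gone ?survive_ge0 // pend_step negb_and negbK; apply/orP; right.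
  exact: (switch_succeeds (ck fbT) pure b0 ba pq pi).
(* Acknowledgements: nobody leaves in the honest blocking slot, so the pending set after the
   deviation is contained in the honest one. *)
apply: survive_mono => // [j /pend_stepW pj|j l c /pend_stepW pj].
  by rewrite -run_rcons stays.
have rlenA m' : rlen fb m' = 0%N by rewrite /rlen fbA.
rewrite !hist_step // !rlenA ffunE /Ss /Sp /dev.
have [->|ji] := eqVneq j i; last by [].
rewrite hi qi !force_after ?size_cat ?size_rcons; try lia.
exact: mimic_after.
Qed.

Lemma survive_switch1 w : same_hist h (run fb w) ->
  pend (run fb w) i -> survive fb Ss i (run fb w) 1 = 0.
Proof.
move=> sh pi; rewrite survive_mimic ?sh // big1 // => q _.
have [->|pq] := eq0_or_gt0 (slotw_ge0 (run fb w) q (valid_anon vp)); first by rewrite mul0r.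
rewrite survive_gone ?mulr0 // pend_step negb_and negbK; apply/orP; right.
exact: (switch_succeeds sh pure b0 ba pq pi).
Qed.

Lemma survive_honest1 w : size w = size h -> 0 < weight fb (anon p) w ->
  pend (run fb w) i -> hist (run fb w) i = h -> survive fb Sp i (run fb w) 1 = 1.
Proof.
move=> sw pw pi hi; rewrite survive_honest //.
rewrite -(sum_slotw (run fb w) (valid_anon vp)); apply: eq_bigr => q _.
have [->|pq] := eq0_or_gt0 (slotw_ge0 (run fb w) q (valid_anon vp)); first by rewrite mul0r.
rewrite /survive expect0 -run_rcons stays ?mulr1 //.
by rewrite weight_rcons_gt0 ?pw //; exact: valid_anon.
Qed.

(** The latency series are compared term by term; the run [w] makes one term strictly smaller, and
    finiteness keeps the inequality strict. *)
Lemma switch_improves w :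
  (fb = Ternary -> forall w', size w' = size h -> 0 < weight fb (anon p) w' ->
     pend (run fb w') i -> hist (run fb w') i = h -> same_hist h (run fb w')) ->
  size w = size h -> 0 < weight fb (anon p) w -> pend (run fb w) i ->
  same_hist h (run fb w) -> (exp_latency fb (anon p) i < +oo)%E ->
  0 < Prob fb Sp (size h) (hist_event fb i h) /\
  (cond_exp_latency fb p i h s < cond_exp_latency fb p i h p)%E.
Proof.
move=> ck sw pw pi sh fin.
have hi : hist (run fb w) i = h by exact: sh.
have H0 : 0 < hist_weight p h by exact: (hist_weight_gt0 pw pi hi).
have szw : size w == size h by rewrite sw.
have hew : hist_event fb i h w by apply/(hist_eventP _ sw).
have pSw s' : 0 < weight fb (dev p i (force h s')) w.
  by rewrite weight_force // mulr_gt0 ?invr_gt0.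
have PA0 : 0 < Prob fb Sp (size h) (hist_event fb i h).
  rewrite /Prob (bigD1 (Tuple szw)) //= hew mulr1 ltr_pwDl ?pSw // sumr_ge0 // => u _.
  by rewrite mulr_ge0 ?weight_ge0.
split=> //; rewrite /cond_exp_latency -/Ss -/Sp lteD2lE //.
(* Both conditional laws have the same normalisation. *)
have -> : Prob fb Ss (size h) (hist_event fb i h) = Prob fb Sp (size h) (hist_event fb i h).
  apply: eq_bigr => u _; case: (boolP (hist_event fb i h u)) => he; last by rewrite !mulr0.
  by rewrite !weight_force ?size_tuple.
set PA := Prob _ Sp _ _ in PA0 *.
have le_term m (u : (size h).-tuple (profile n k)) :
    weight fb Ss u * (hist_event fb i h u)%:R * survive fb Ss i (run fb u) m <=
    weight fb Sp u * (hist_event fb i h u)%:R * survive fb Sp i (run fb u) m.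
  case: (boolP (hist_event fb i h u)) => he; last by rewrite !(mulr0, mul0r).
  have [pu hu] := hist_eventP i (size_tuple u) he.
  rewrite !weight_force ?size_tuple // !mulr1 -!mulrA ler_wpM2l ?invr_ge0 ?(ltW H0) //.
  have [->|pu0] := eq0_or_gt0 (weight_ge0 fb u (@valid_anon R n k p vp)); first by rewrite !mul0r.
  apply: ler_wpM2l; first exact: ltW.
  by apply: survive_switch_le; rewrite ?size_tuple // => fbT; apply: ck; rewrite ?size_tuple.
(* Term 1 is survival of the blocking slot: along [w] it is 0 after deviating and 1 otherwise. *)
apply: (@nneseries_lt1 _ _ _ 1%N) => [m|m||].
- rewrite divr_ge0 ?(ltW PA0) // Prob_survive sumr_ge0 // => u _.
  by rewrite !mulr_ge0 ?weight_ge0 ?survive_ge0.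
- by rewrite ler_pM2r ?invr_gt0 // !Prob_survive; apply: ler_sum.
- rewrite ltr_pM2r ?invr_gt0 // !Prob_survive.
  rewrite (bigD1 (Tuple szw)) //= [ltRHS](bigD1 (Tuple szw)) //=.
  rewrite ltr_leD ?ler_sum // hew survive_switch1 // survive_honest1 //.
  by rewrite mulr0 !mulr1 pSw.
pose C := PA^-1 * (hist_weight p h)^-1.
have C0 : 0 <= C by rewrite mulr_ge0 ?invr_ge0 ?(ltW PA0) ?(ltW H0).
have tail0 u : 0 <= tailP fb (@anon R n k p) i u.
  by apply: sumr_ge0 => v _; rewrite mulr_ge0 ?weight_ge0 //; exact: valid_anon.
(* The honest conditional series is at most [C] times a tail of the finite series for the expected
   latency. *)
apply: (@le_lt_trans _ _ (\sum_(m <oo) (C%:E * (tailP fb (anon p) i (m + size h))%:E))%E).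
  apply: lee_nneseries => m _; rewrite ?lee_fin.
    rewrite divr_ge0 ?(ltW PA0) // Prob_survive sumr_ge0 // => u _.
    by rewrite !mulr_ge0 ?weight_ge0 ?survive_ge0.
  rewrite [leLHS]mulrC /C -mulrA ler_wpM2l ?invr_ge0 ?(ltW PA0) // (addnC m).
  exact: survive_tail.
rewrite nneseriesZl => [|m _]; last by rewrite lee_fin.
rewrite (nneseries_addn (f := fun m => (tailP fb (anon p) i m)%:E)) => [|m]; last first.
  by rewrite lee_fin.
rewrite lte_mul_pinfty ?lee_fin //.
apply: le_lt_trans fin; rewrite /exp_latency.
rewrite [leRHS](nneseries_split _ (size h)) => [|m _]; last by rewrite lee_fin.
by rewrite add0n leeDr // sume_ge0 // => m _; rewrite lee_fin.
Qed.

End Blocked.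

End Deviation.

(** * Contradiction with equilibrium *)

Unset Implicit Arguments.

Theorem theorem7 (R : realType) (n k : nat) (fb : feedback) :
  (2 <= k)%N -> (2 <= n)%N ->
  ~ (exists p : rule R k,
        @EBS R n k fb p /\
        forall i : 'I_n, (@exp_latency R n k fb (@anon R n k p) i < +oo)%E).
Proof.
move=> k2 n2 [p [[[vp eqp] [t block]] fin]].
have [h [sz_h [w [sz_w pw w2 sh]] ck]] := common_history fb vp n2 t.
have [i [_ [_ pi _]]] := two_pending w2.
have [a pa] := support_nonempty vp h.
have stays (w' : seq (profile n k)) q j : size w' = size h -> 0 < weight fb (anon p) (rcons w' q) ->
    pend (run fb w') j -> pend (run fb (rcons w' q)) j.
  by rewrite sz_h => sw'; exact: (blocking_stays vp (block j) sw').
have pure c : 0 < p h c -> c = a.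
  move=> pc; apply: (blocking_pure vp _ pw w2 sh pc pa) => q j.
  by apply: stays; rewrite sz_w sz_h.
(* With two channels there are at least three actions, so one is neither silence nor [a]. *)
have [b [b0 ba]] : exists b : action k, b != ord0 /\ b != a.
  have : (2 < #|action k|)%N by rewrite card_ord ltnS.
  move: (cards2 ord0 a); have := cardsC [set ord0; a].
  case: (set_0Vmem (~: [set ord0; a])) => [->|[b]]; last first.
    by rewrite !inE negb_or => /andP[]; exists b.
  by rewrite cards0 addn0 => ->; case: (_ != _) => ->.
have := @switch_improves R n k fb p vp i h a b pure b0 ba stays w.
case => //; [|by rewrite sz_w|].
  by move=> fbT w' sw'; apply: ck; rewrite // sw'.
by move=> PA0; rewrite ltNge eqp //; exact: valid_mimic.
Qed.
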